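(* Let $\Delta$ be a $1$-dimensional matroid on $[n]=\{1,\ldots,n\}$, whose $1$-skeleton is the complete $p$-partite graph with partition sets $A_1,\ldots,A_p$. For $k=1,\ldots,n-1$ set $c_k(\Delta)=|\{i\in\{1,\ldots,p\} : |A_i|\ge k\}|-1$. Then for all $k=0,\ldots,n-2$, $$h^{\Delta}(k)=\sum_{i=1}^{n-k-1}c_i(\Delta).$$
   Context: A matroid on $[n]$ is identified with its simplicial complex $\Delta$ of independent sets (a simplicial complex such that for $F,G\in\Delta$ with $|F|<|G|$ there is $i\in G\setminus F$ with $F\cup\{i\}\in\Delta$); every $v\in[n]$ is assumed to be a vertex of $\Delta$. A $1$-dimensional matroid, viewed as a graph whose edges are the two-element faces, is a complete $p$-partite graph for some $p\ge2$: $[n]$ is partitioned into nonempty sets $A_1,\ldots,A_p$ and $\{v,w\}$ is an edge iff $v,w$ lie in different $A_i$. $\Bbbk$ is a field, $S=\Bbbk[x_1,\ldots,x_n]$, $J(\Delta)=\bigcap_{F\text{ facet of }\Delta}(x_i : i\in F)$ is the cover ideal, and $h^\Delta=(h^\Delta(0),h^\Delta(1),\ldots)$ is the $h$-vector of $S/J(\Delta)$, i.e. the coefficient vector of the polynomial $h(t)$ with Hilbert series of $S/J(\Delta)$ equal to $h(t)/(1-t)^{\dim S/J(\Delta)}$. *)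

(* Defs.v *)
From HB Require Import structures.
From mathcomp Require Import all_boot all_order all_algebra.
From mathcomp Require Import ring_quotient mpoly.
From Stdlib Require Import ClassicalEpsilon.

Set Implicit Arguments.
Unset Strict Implicit.
Unset Printing Implicit Defensive.

Import GRing.Theory.
Local Open Scope ring_scope.

Section Complexes.
Variable n : nat.
Implicit Types (Delta : {set {set 'I_n}}) (F G : {set 'I_n}).

Definition simplicial_complex Delta : Prop :=
  set0 \in Delta /\
  forall F G, F \subset G -> G \in Delta -> F \in Delta.

Definition matroid_complex Delta : Prop :=
  [/\ simplicial_complex Delta,
      forall v : 'I_n, [set v] \in Delta
    & forall F G, F \in Delta -> G \in Delta -> (#|F| < #|G|)%N ->
        exists2 i, i \in G :\: F & i |: F \in Delta].

Definition complex_dim Delta : int :=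
  (\max_(F in Delta) #|F|)%N%:Z - 1.

Definition facet Delta F : bool := maxset (fun G => G \in Delta) F.

Definition edge Delta : rel 'I_n :=
  fun v w => (v != w) && ([set v; w] \in Delta).

Definition complete_multipartite (e : rel 'I_n) (p : nat)
    (A : 'I_p -> {set 'I_n}) : Prop :=
  [/\ (2 <= p)%N,
      forall i, A i != set0,
      forall i j, i != j -> [disjoint A i & A j],
      \bigcup_(i < p) A i = [set: 'I_n]
    & forall v w, e v w <->
        exists i j, [/\ i != j, v \in A i & w \in A j]].

(* Integer-valued, because it is -1 when every part has fewer than k
   elements. *)
Definition part_count (p : nat) (A : 'I_p -> {set 'I_n}) (k : nat) : int :=
  #|[set i : 'I_p | (k <= #|A i|)%N]|%:Z - 1.

End Complexes.

Section HVector.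
Variables (K : fieldType) (n : nat).
Implicit Types (I : {mpoly K[n]} -> Prop) (f : {mpoly K[n]}).

(* The ideal generated by the variables x_i with i in F. *)
Definition var_ideal (F : {set 'I_n}) f : Prop :=
  exists g : 'I_n -> {mpoly K[n]}, f = \sum_(i in F) g i * 'X_i.

Definition cover_ideal (Delta : {set {set 'I_n}}) f : Prop :=
  forall F, facet Delta F -> var_ideal F f.

(* For a homogeneous ideal I, the degree d component of S/I is S_d modulo
   the intersection of I and S_d; the classes of b form a K-basis of it. *)
Definition graded_quot_dim I (d m : nat) : Prop :=
  exists b : 'I_m -> {mpoly K[n]},
    [/\ forall j, b j \is d.-homog,
        forall c : 'I_m -> K, I (\sum_j c j *: b j) -> forall j, c j = 0
      & forall f, f \is d.-homog ->
          exists c : 'I_m -> K, I (f - \sum_j c j *: b j)].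

(* Prime ideals of S/I are given as prime ideals of S containing I
   (idealr_closed includes properness). *)
Definition prime_chain I (d : nat) : Prop :=
  exists P : 'I_d.+1 -> {pred {mpoly K[n]}},
    [/\ forall i, idealr_closed (P i) /\ prime_idealr_closed (P i),
        forall i f, I f -> f \in P i
      & forall i j : 'I_d.+1, (i < j)%N ->
          {subset P i <= P j} /\ exists2 f, f \in P j & f \notin P i].

Definition krull_dim_quot I (d : nat) : Prop :=
  prime_chain I d /\ forall e, prime_chain I e -> (e <= d)%N.

(* H is the Hilbert function of S/I and D its Krull dimension; the last
   clause is (1 - t)^D * (sum_d H(d) t^d) = h(t) as formal power series. *)
Definition h_polynomial_spec I (h : {poly int}) : Prop :=
  exists (H : nat -> nat) (D : nat),
    [/\ forall d, graded_quot_dim I d (H d),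
        krull_dim_quot I D
      & forall m, \sum_(j < m.+1) ((1 - 'X : {poly int}) ^+ D)`_j
                                  * (H (m - j)%N)%:Z = h`_m].

(* For an ideal I the spec has at most one solution h. *)
Definition h_polynomial I : {poly int} :=
  epsilon (inhabits (0 : {poly int})) (h_polynomial_spec I).

Definition h_vector I (k : nat) : int := (h_polynomial I)`_k.

End HVector.

Definition h_matroid (K : fieldType) (n : nat) (Delta : {set {set 'I_n}}) :
  nat -> int := h_vector (@cover_ideal K n Delta).

(* Main.v *)
Require Import Defs.
From HB Require Import structures.
From mathcomp Require Import all_boot all_order all_algebra.
From mathcomp Require Import ring_quotient mpoly zify ring.
From Stdlib Require Import ClassicalEpsilon.

(** The monomials outside the cover ideal are those whose set of absent variables
    is not contained in a single part.  Inclusion-exclusion over the parts gives the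
    Hilbert series [(1 - sum_j t^(n - a_j) + (p - 1) t^n) / (1 - t)^n], where
    [a_j = #|A j|], and the claimed [h]-polynomial times [(1 - t)^2] equals the
    same numerator.  That the quotient has dimension [n - 2] follows from chains
    of primes generated by variables and, for the upper bound, from the fact that a
    prime containing the cover ideal contains both variables of some edge, while
    [n - 1] polynomials are algebraically dependent modulo two variables. *)

Set Implicit Arguments.
Unset Strict Implicit.
Unset Printing Implicit Defensive.

Import GRing.Theory.
Local Open Scope ring_scope.

(** * Linear dependence and sums over tuples *)

Lemma linear_dependence (K : fieldType) (T B : finType) (phi : T -> B -> K) :
  (#|B| < #|T|)%N ->
  exists c : T -> K, (exists t, c t != 0) /\ forall b, \sum_t c t * phi t b = 0.
Proof.
move=> ltBT.
pose M := \matrix_(i < #|T|, j < #|B|) phi (enum_val i) (enum_val j).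
have /rowV0Pn[v /sub_kermxP vM vn0] : kermx M != 0.
  rewrite -mxrank_eq0 mxrank_ker subn_eq0 -ltnNge.
  exact: leq_ltn_trans (rank_leq_col M) ltBT.
exists (fun t => v 0 (enum_rank t)); split.
  have /rV0Pn[i vi] := vn0.
  by exists (enum_val i); rewrite enum_valK.
move=> b; have /matrixP/(_ 0 (enum_rank b)) := vM.
rewrite !mxE => {2}<-; rewrite (reindex_onto enum_val enum_rank) /=; last first.
  by move=> t _; rewrite enum_rankK.
apply: eq_big => [i|i _]; first by rewrite enum_valK eqxx.
by rewrite enum_valK mxE enum_rankK.
Qed.

Lemma big_tuple_cons (V : nmodType) (T : finType) (e : nat)
    (G : e.+1.-tuple T -> V) :
  \sum_u G u = \sum_(a : T) \sum_(v : e.-tuple T) G [tuple of a :: v].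
Proof.
rewrite pair_big /=.
rewrite (reindex (fun q : T * e.-tuple T => [tuple of q.1 :: q.2])) //=.
exists (fun u : e.+1.-tuple T => (thead u, [tuple of behead u])).
  by move=> [a v] _ /=; congr (_, _); apply: val_inj.
by move=> u _ /=; rewrite [RHS]tuple_eta; apply: val_inj.
Qed.

(** * Ideals and primes as closed predicates *)

Section IdealClosed.
Variables (R : nzRingType) (P : {pred R}).
Hypothesis idP : idealr_closed P.

Lemma ideal0 : 0 \in P. Proof. by case: idP. Qed.

Lemma idealD u v : u \in P -> v \in P -> u + v \in P.
Proof. by case: idP => _ _ h uP vP; rewrite -[u]mul1r h. Qed.

Lemma idealMl a u : u \in P -> a * u \in P.
Proof. by case: idP => P0 _ h uP; rewrite -[_ * _]addr0 h. Qed.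

Lemma idealB u v : u \in P -> v \in P -> u - v \in P.
Proof. by move=> uP vP; rewrite -[- v]mulN1r idealD // idealMl. Qed.

Lemma ideal_sum (I : eqType) (r : seq I) (Q : pred I) (F : I -> R) :
  (forall i, i \in r -> Q i -> F i \in P) -> \sum_(i <- r | Q i) F i \in P.
Proof.
move=> FP; rewrite big_seq_cond; apply: (big_ind (fun x => x \in P)).
- exact: ideal0.
- exact: idealD.
- by move=> i /andP[]; apply: FP.
Qed.

Hypothesis prP : prime_idealr_closed P.

Lemma prime_prod_notin (I : Type) (r : seq I) (Q : pred I) (F : I -> R) :
  (forall i, Q i -> F i \notin P) -> \prod_(i <- r | Q i) F i \notin P.
Proof.
move=> FP; apply: (big_ind (fun x => x \notin P)) => //.
  by case: idP.
by move=> x y xP yP; apply/negP => /prP; rewrite (negbTE xP) (negbTE yP).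
Qed.

Lemma prime_exp_notin x k : x \notin P -> x ^+ k \notin P.
Proof.
by move=> xP; rewrite -[k]card_ord -prodr_const; apply: prime_prod_notin.
Qed.
End IdealClosed.

(** * Independence of elements taken along a chain of primes *)

Lemma factor_lowest_power (R : comNzRingType) (x : R) (N : nat) (S : 'I_N -> R)
    (k : 'I_N) :
  (forall a : 'I_N, (a < k)%N -> S a = 0) ->
  exists r, \sum_(a < N) x ^+ a * S a = x ^+ k * (S k + x * r).
Proof.
move=> S0; exists (\sum_(a < N | (k < a)%N) x ^+ (a - k.+1) * S a).
rewrite (bigD1 k) //= mulrDr !mulr_sumr; congr (_ + _).
rewrite big_mkcond [RHS]big_mkcond; apply: eq_bigr => a _ /=.
case: (ltngtP a k) => [ak|ka|/val_inj ->]; last by rewrite eqxx.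
  by rewrite S0 // mulr0 if_same.
rewrite ifT; last by apply: contraTN ka => /eqP ->; rewrite ltnn.
by rewrite !mulrA -exprSr -exprD subnKC.
Qed.

(* Coquand-Lombardi: after dividing by the lowest power of [x 0], a relation
   modulo [P 0] becomes a relation in [x 1, x 2, ...] modulo [P 1]. *)
Lemma prime_chain_independent (R : comNzRingType) (N e : nat)
    (P : nat -> {pred R}) (x : nat -> R) (c : e.-tuple 'I_N -> R) :
  (forall i, (i <= e)%N -> idealr_closed (P i) /\ prime_idealr_closed (P i)) ->
  (forall i, (i < e)%N ->
     [/\ {subset P i <= P i.+1}, x i \in P i.+1 & x i \notin P i]) ->
  (forall u, c u \in P e -> c u = 0) ->
  \sum_u c u * \prod_(i < e) x i ^+ tnth u i \in P 0 ->
  forall u, c u = 0.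
Proof.
elim: e => [|e IH] in P x c *.
  move=> _ _ c0; rewrite (big_pred1 [tuple]); last first.
    by move=> u; apply/esym/eqP; apply: tuple0.
  by rewrite big_ord0 mulr1 => cP u; rewrite [u]tuple0; apply: c0.
move=> primeP chainP c0; rewrite big_tuple_cons.
pose S (a : 'I_N) := \sum_(v : e.-tuple 'I_N) c [tuple of a :: v] *
  \prod_(i < e) x i.+1 ^+ tnth v i.
have -> : \sum_(a < N) \sum_(v : e.-tuple 'I_N) c [tuple of a :: v] *
    \prod_(i < e.+1) x i ^+ tnth [tuple of a :: v] i
  = \sum_(a < N) x 0 ^+ a * S a.
  apply: eq_bigr => a _; rewrite mulr_sumr; apply: eq_bigr => v _.
  rewrite big_ord_recl mulrCA; congr (_ * (_ * _)); apply: eq_bigr => i _.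
  by rewrite tnthS.
have [id0 pr0] := primeP 0 isT; have [id1 _] := primeP 1 isT.
have [sub01 x01 x00] := chainP 0 isT.
move=> SP.
(* Induction on the first exponent: when all coefficients with first exponent below [a] vanish,
   [x 0 ^+ a] is the lowest power left. *)
suff cz (k : nat) (a : 'I_N) : (a < k)%N ->
    forall v : e.-tuple 'I_N, c [tuple of a :: v] = 0.
  by move=> u; rewrite [u]tuple_eta; apply: (cz _ _ (ltnSn _)).
elim: k a => // k IHk a ak.
have S0 (b : 'I_N) : (b < a)%N -> S b = 0.
  move=> ba; rewrite /S big1 // => v _.
  by rewrite IHk ?mul0r //; apply: leq_trans ba _; rewrite -ltnS.
have [r def] := factor_lowest_power (x 0) S0.
(* Primality cancels [x 0 ^+ a] because [x 0] is not in [P 0]; modulo [P 1], which contains [x 0],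
   only [S a] remains. *)
move: SP; rewrite def => /pr0; rewrite (negbTE (prime_exp_notin id0 pr0 _ x00)) /=.
move/sub01 => SrP; apply: (IH (fun i => P i.+1) (fun i => x i.+1)).
- by move=> i ie; apply: primeP.
- by move=> i ie; apply: chainP.
- by move=> v; apply: c0.
- rewrite -/(S a) -[S a](addrK (x 0 * r)) idealB // mulrC idealMl //.
Qed.

(** * Ideals generated by variables *)

Section MonomialCoefficients.
Variables (K : fieldType) (n : nat).
Implicit Types (f : {mpoly K[n]}) (F G : {set 'I_n}) (m : 'X_{1..n}).

Definition vanishes_on F m := [forall i in F, m i == 0%N].

Definition kill_vars F f : {mpoly K[n]} :=
  f \mPo [tuple (if i \in F then 0 else 'X_i) | i < n].

(** As the kernel of a ring morphism into a domain this is visibly prime, and it is a boolean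
    predicate, as prime chains require; [var_idealP] identifies it with [var_ideal]. *)
Definition killed_ideal F : {pred {mpoly K[n]}} := [pred f | kill_vars F f == 0].

Lemma mcoeff_kill_vars F f m :
  (kill_vars F f)@_m = if vanishes_on F m then f@_m else 0.
Proof.
have killX m' : kill_vars F 'X_[m'] = if vanishes_on F m' then 'X_[m'] else 0.
  rewrite /kill_vars comp_mpolyX; case: ifP => [/forallP F0|].
    rewrite [RHS]mpolyXE_id; apply: eq_bigr => i _; rewrite tnth_mktuple.
    by have := F0 i; case: (i \in F) => //= /eqP ->.
  case/forallPn=> i; rewrite negb_imply => /andP[iF mi].
  by rewrite (bigD1 i) //= tnth_mktuple iF expr0n (negbTE mi) mul0r.
rewrite /kill_vars comp_mpolyEX raddf_sum /=.
under eq_bigr => m' _ do rewrite -/(kill_vars F _) killX mcoeffZ.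
rewrite [in RHS](mpolyE f) raddf_sum /=; case: ifP => Fm.
  apply: eq_bigr => m' _; rewrite mcoeffZ mcoeffX; case: eqP => [->|/eqP ne].
    by rewrite Fm mcoeffX eqxx.
  by case: ifP => _; rewrite ?mcoeff0 // mcoeffX (negbTE ne).
rewrite big1 // => m' _; case: ifP => Fm'; last by rewrite mcoeff0 mulr0.
by rewrite mcoeffX; case: eqP Fm' Fm => [-> ->|] //; rewrite mulr0.
Qed.

Lemma killed_idealP F f :
  reflect (forall m, vanishes_on F m -> f@_m = 0) (f \in killed_ideal F).
Proof.
apply: (iffP eqP) => [f0 m Fm|f0]; last apply/mpolyP => m.
  by have := mcoeff_kill_vars F f m; rewrite f0 Fm mcoeff0.
by rewrite mcoeff_kill_vars mcoeff0; case: ifP => // /f0.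
Qed.

Lemma killed_ideal_prime F :
  idealr_closed (killed_ideal F) /\ prime_idealr_closed (killed_ideal F).
Proof.
rewrite /killed_ideal /kill_vars; split; first split.
- by rewrite inE rmorph0.
- by rewrite inE rmorph1 oner_eq0.
- move=> a u v; rewrite !inE => /eqP u0 /eqP v0.
  by rewrite rmorphD rmorphM /= u0 v0 mulr0 addr0.
- by move=> u v; rewrite !inE rmorphM mulf_eq0.
Qed.

Lemma killed_idealX F i : ('X_i \in killed_ideal F) = (i \in F).
Proof.
rewrite inE /kill_vars comp_mpolyXU -tnth_nth tnth_mktuple.
by case: ifP; rewrite ?eqxx // -msupp_eq0 msuppX.
Qed.

Lemma killed_ideal_sub F G : F \subset G -> {subset killed_ideal F <= killed_ideal G}.
Proof.
move=> /subsetP FG f /killed_idealP f0; apply/killed_idealP => m Gm.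
apply: f0; apply/forallP => i; apply/implyP => /FG iG.
by have /forallP/(_ i) := Gm; rewrite iG.
Qed.

Lemma var_idealP F f : var_ideal F f <-> f \in killed_ideal F.
Proof.
have [idF _] := killed_ideal_prime F; split=> [[g ->]|/killed_idealP f0].
  by apply: (ideal_sum idF) => i _ iF; rewrite idealMl // killed_idealX.
(* [p] assigns to each monomial one variable of [F] dividing it; the coefficient of ['X_i] collects
   the terms assigned to [i], divided by ['X_i]. *)
pose p m := [pick i in F | m i != 0%N].
exists (fun i => \sum_(m <- msupp f | p m == Some i) f@_m *: 'X_[m - U_(i)]).
under eq_bigr => i _ do rewrite mulr_suml.
rewrite (exchange_big_dep predT) //= {1}[f]mpolyE; apply: eq_big_seq => m mf.
case E : (p m) => [i|]; move: E; rewrite /p; case: pickP => //.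
  move=> j /andP[jF mj] [<-]; rewrite (big_pred1 j) => [|k]; last first.
    by apply/andP/eqP => [[_ /eqP[]]|->].
  by rewrite -scalerAl -mpolyXD submK // lep1mP.
move=> none _; rewrite f0 ?scale0r ?big_pred0 //; first by move=> i; rewrite andbF.
by apply/forallP => i; apply/implyP => iF; have := none i; rewrite iF /= => /negbFE.
Qed.

(** Adjoining the variables outside [F] one at a time to the ideal of [F] gives a chain of primes;
    each step is strict because the new variable lies only in the larger ideal. *)
Lemma krull_chain F (I : {mpoly K[n]} -> Prop) :
  (forall f, I f -> var_ideal F f) -> prime_chain I (n - #|F|).
Proof.
move=> IF; pose s := enum (~: F).
have szs : size s = (n - #|F|)%N by rewrite -cardE cardsCs setCK card_ord.
pose G k := F :|: [set i in take k s].
exists (fun k => killed_ideal (G k)); split.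
- by move=> k; apply: killed_ideal_prime.
- move=> k f /IF/var_idealP; apply: killed_ideal_sub; exact: subsetUl.
move=> i j ij; split.
  apply: killed_ideal_sub; apply: setUS; apply/subsetP => v; rewrite !inE.
  by rewrite -(take_takel s (ltnW ij)) => /mem_take.
have is_ : (i < size s)%N by rewrite szs; have := ltn_ord j; lia.
have x0 : 'I_n by case: (s) is_ => // x.
exists 'X_(nth x0 s i).
  rewrite killed_idealX !inE; apply/orP; right.
  rewrite -(nth_take x0 ij); apply: mem_nth; rewrite size_take; case: ifP => //.
rewrite killed_idealX !inE negb_or; apply/andP; split.
  by have := mem_nth x0 is_; rewrite mem_enum inE.
rewrite in_take ?mem_nth // index_uniq ?enum_uniq // ltnn //.
Qed.
End MonomialCoefficients.

(** * Upper bound on the Krull dimension *)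

Section KrullBound.
Variables (K : fieldType) (n : nat).
Implicit Types (f g : {mpoly K[n]}) (F : {set 'I_n}).

Lemma msizeM_leD f g (a b : nat) :
  (msize f <= a.+1)%N -> (msize g <= b.+1)%N -> (msize (f * g) <= (a + b).+1)%N.
Proof.
have [->|f0] := eqVneq f 0; first by rewrite mul0r msize0.
have [->|g0] := eqVneq g 0; first by rewrite mulr0 msize0.
by move=> fa gb; have := leq_add fa gb; rewrite msizeM // addSn addnS; case: (_ + _)%N.
Qed.

Lemma msize_prod_exp (e : nat) (x : 'I_e -> {mpoly K[n]}) (u : 'I_e -> nat) :
  (msize (\prod_i x i ^+ u i) <= (\sum_i u i * msize (x i)).+1)%N.
Proof.
apply: (big_ind2 (fun (p : {mpoly K[n]}) d => msize p <= d.+1)%N).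
- by rewrite msize1.
- by move=> p d q d'; apply: msizeM_leD.
move=> i _; elim: (u i) => [|k IH]; first by rewrite expr0 msize1.
by rewrite exprS mulSn msizeM_leD // ltnW.
Qed.

Lemma mem_ideal_vars F (P : {pred {mpoly K[n]}}) f :
  idealr_closed P -> (forall i, i \in F -> 'X_i \in P) ->
  (forall m, vanishes_on F m -> f@_m = 0) -> f \in P.
Proof.
move=> idP XP /killed_idealP/var_idealP[g ->].
by apply: (ideal_sum idP) => i _ iF; rewrite idealMl // XP.
Qed.

(* Counting argument: modulo the variables in [F], the [N ^ e] monomials in
   [x 0, ..., x e.-1] with exponents below [N] all lie in a space of dimension
   [O(N ^ (n - #|F|))], so they are dependent for large [N] if [e > n - #|F|]. *)
Lemma krull_bound F (I : {mpoly K[n]} -> Prop) (e : nat) :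
  (forall P : {pred {mpoly K[n]}}, idealr_closed P -> prime_idealr_closed P ->
     (forall f, I f -> f \in P) ->
     exists2 G : {set 'I_n}, #|G| = #|F| & forall i, i \in G -> 'X_i \in P) ->
  prime_chain I e -> (e <= n - #|F|)%N.
Proof.
move=> IP [P0 [primeP0 IP0 chainP0]]; rewrite leqNgt; apply/negP => lt_re.
have [id0 pr0] := primeP0 ord0.
have [G GF GP] := IP _ id0 pr0 (IP0 ord0).
move: lt_re; rewrite -{F IP}GF; set r := (n - #|G|)%N => lt_re.
(* [inord] turns the chain into a family over [nat], as [prime_chain_independent] expects; only
   indices up to [e] matter. *)
pose P i := P0 (inord i).
have primeP i : (i <= e)%N -> idealr_closed (P i) /\ prime_idealr_closed (P i).
  by move=> _; apply: primeP0.
have ex_chainP i : exists x, (i < e)%N ->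
    [/\ {subset P i <= P i.+1}, x \in P i.+1 & x \notin P i].
  case: (ltnP i e) => [ie|]; last by exists 0.
  have [|sub [x xP xnP]] := chainP0 (inord i) (inord i.+1).
    by rewrite !inordK ?ltnS // ltnW.
  by exists x.
pose x i := proj1_sig (constructive_indefinite_description _ (ex_chainP i)).
have chainP i : (i < e)%N ->
    [/\ {subset P i <= P i.+1}, x i \in P i.+1 & x i \notin P i].
  by rewrite /x; case: constructive_indefinite_description.
pose D := (\sum_(i < e) msize (x i))%N.
(* [N] exceeds [D.+1 ^ r], so [(N * D.+1) ^ r < N ^ r.+1 <= N ^ e]; and [B], which is at most
   [N * D.+1], bounds the [msize] of every [y u] below. *)
pose N := ((D.+1) ^ r).+1.
pose B := (N * D).+1.
pose T := {ffun {i | i \notin G} -> 'I_B}.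
pose mon (b : T) : 'X_{1..n} :=
  [multinom (if insub i is Some j then b j : nat else 0%N) | i < n].
pose y (u : e.-tuple 'I_N) := \prod_(i < e) x i ^+ tnth u i.
have cardT : #|T| = (B ^ r)%N.
  rewrite card_ffun card_ord card_sig; congr (_ ^ _)%N.
  by apply: (canRL (addKn _)); rewrite -[RHS]card_ord -(cardC G).
have lt_dim : (#|T| < #|{: e.-tuple 'I_N}|)%N.
  rewrite cardT card_tuple card_ord.
  apply: (@leq_ltn_trans ((N * D.+1) ^ r)).
    by case: (r) => // r'; rewrite leq_exp2r // /B mulnS -add1n leq_add2r.
  rewrite expnMn; apply: (@leq_trans (N ^ r.+1)); last by rewrite leq_pexp2l.
  by rewrite expnSr ltn_pmul2l ?expn_gt0.
have [c [[u0 cu0] c_dep]] :=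
  linear_dependence (fun u (b : T) => (y u)@_(mon b)) lt_dim.
suff cz u : (c u)%:MP = 0 :> {mpoly K[n]}.
  by move/eqP: (cz u0); rewrite mpolyC_eq0 (negbTE cu0).
move: u; apply: (@prime_chain_independent _ N e P x _ primeP chainP) => [u|].
  (* A nonzero constant is a unit, so it cannot lie in the proper ideal [P e]. *)
  have [[_ P1 _] _] := primeP e (leqnn e).
  case: (eqVneq (c u) 0) => [->|cu]; first by rewrite mpolyC0.
  move=> /(idealMl (primeP e (leqnn e)).1 (c u)^-1%:MP).
  by rewrite -mpolyCM mulVf // (negbTE P1).
apply: (mem_ideal_vars (F := G)); first exact: (primeP 0 isT).1.
  by move=> i /GP; rewrite /P (_ : inord 0 = ord0) //; apply/val_inj; rewrite /= inordK.
(* Monomials of degree at least [B] occur in no [y u]; below that degree all exponents fit in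
   ['I_B], so a monomial avoiding [G] is some [mon b]. *)
move=> m Gm; have [mB|Bm] := leqP B (mdeg m).
  rewrite raddf_sum big1 //= => u _; rewrite mcoeffCM memN_msupp_eq0 ?mulr0 //.
  apply: msize_mdeg_ge; apply: leq_trans mB.
  apply: leq_trans (msize_prod_exp _ _) _; rewrite ltnS /D big_distrr /=.
  by apply: leq_sum => i _; rewrite leq_mul2r [X in _ || X]ltnW ?orbT.
have lt_m i : (m i < B)%N.
  by apply: leq_ltn_trans Bm; rewrite mdegE (bigD1 i) //= leq_addr.
have -> : m = mon [ffun j => Ordinal (lt_m (val j))].
  apply/mnmP => i; rewrite mnmE; case: insubP => [j _ <-|].
    by rewrite ffunE.
  by rewrite negbK => iG; have /forallP/(_ i) := Gm; rewrite iG /= => /eqP.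
rewrite raddf_sum /= -[RHS](c_dep [ffun j => Ordinal (lt_m (val j))]).
by apply: eq_bigr => u _; rewrite mcoeffCM.
Qed.
End KrullBound.

(** * Hilbert functions via standard monomials *)

Section StandardMonomials.
Variables (K : fieldType) (n : nat) (I : {mpoly K[n]} -> Prop).
Variable std : pred 'X_{1..n}.
Hypothesis memI : forall f, I f <-> forall m, std m -> f@_m = 0.

Definition exps_mnm M (u : {ffun 'I_n -> 'I_M}) : 'X_{1..n} :=
  [multinom (u i : nat) | i < n].

(* Exponents are capped by [M] only to have a finite index type; any [M > d]
   gives the same cardinal. *)
Definition std_exps M d : {set {ffun 'I_n -> 'I_M}} :=
  [set u | (mdeg (exps_mnm u) == d) && std (exps_mnm u)].

Lemma exps_mnm_inj M : injective (@exps_mnm M).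
Proof.
move=> u v /mnmP uv; apply/ffunP => i; apply/val_inj.
by have := uv i; rewrite !mnmE.
Qed.

(** Since [I] is spanned by the nonstandard monomials, the standard ones of degree [d] form a basis;
    independence and spanning are read off coefficient by coefficient. *)
Lemma graded_quot_dim_std M d :
  (d < M)%N -> graded_quot_dim I d #|std_exps M d|.
Proof.
move=> dM; pose mon (j : 'I_#|std_exps M d|) := exps_mnm (enum_val j).
have mcoeff_comb c m : (\sum_j c j *: ('X_[mon j] : {mpoly K[n]}))@_m
    = \sum_j c j * (mon j == m)%:R.
  by rewrite raddf_sum; apply: eq_bigr => j _; rewrite /= mcoeffZ mcoeffX.
have mon_inj : injective mon by move=> i j /exps_mnm_inj/enum_val_inj.
have monP j : mdeg (mon j) = d /\ std (mon j).
  by have := enum_valP j; rewrite inE => /andP[/eqP].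
exists (fun j => 'X_[mon j]); split.
- by move=> j; rewrite dhomogX /= (monP j).1.
- move=> c /memI cI j; have := cI _ (monP j).2.
  rewrite mcoeff_comb (bigD1 j) //= eqxx mulr1 big1 ?addr0 // => i ij.
  by rewrite (inj_eq mon_inj) (negbTE ij) mulr0.
move=> f homf; exists (fun j => f@_(mon j)); apply/memI => m stdm.
rewrite mcoeffB mcoeff_comb; have [md|md] := eqVneq (mdeg m) d; last first.
  rewrite (dhomog_nemf_coeff homf md) big1 ?subr0 // => j _.
  case: eqP => [mj|]; last by rewrite mulr0.
  by move: md; rewrite -mj (monP j).1 eqxx.
have lt_m i : (m i < M)%N.
  by apply: leq_ltn_trans dM; rewrite -md mdegE (bigD1 i) //= leq_addr.
pose u := [ffun i => Ordinal (lt_m i)].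
have um : exps_mnm u = m by apply/mnmP => i; rewrite mnmE ffunE.
have uS : u \in std_exps M d by rewrite inE um md eqxx.
have mj : mon (enum_rank_in uS u) = m by rewrite /mon enum_rankK_in.
rewrite (bigD1 (enum_rank_in uS u)) //= mj eqxx mulr1 big1 ?addr0 ?subrr //.
by move=> j jm; rewrite -mj (inj_eq mon_inj) (negbTE jm) mulr0.
Qed.

(** If [a < b], the coordinates of the second basis in terms of the first are linearly dependent,
    which puts a nontrivial combination of the second basis in [I]. *)
Lemma graded_quot_dim_le d a b :
  graded_quot_dim I d a -> graded_quot_dim I d b -> (b <= a)%N.
Proof.
move=> [e [_ _ spane]] [e' [home' freee' _]].
rewrite leqNgt; apply/negP => ltab.
have /fin_all_exists[phi phiP] : forall j, exists c, I (e' j - \sum_k c k *: e k).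
  by move=> j; apply: spane.
have [|c [[j cj] c_dep]] := @linear_dependence K 'I_b 'I_a phi.
  by rewrite !card_ord.
move/eqP: cj; apply; apply: (freee' c); apply/memI => m stdm.
have e'm i : (e' i)@_m = \sum_k phi i k * (e k)@_m.
  have /memI/(_ m stdm)/eqP := phiP i; rewrite mcoeffB subr_eq0 => /eqP ->.
  by rewrite raddf_sum; apply: eq_bigr => k _; rewrite /= mcoeffZ.
rewrite raddf_sum /=; under eq_bigr => i _ do rewrite mcoeffZ e'm mulr_sumr.
rewrite exchange_big big1 //= => k _.
under eq_bigr => i _ do rewrite mulrA.
by rewrite -mulr_suml c_dep mul0r.
Qed.

Lemma graded_quot_dim_uniq d a b :
  graded_quot_dim I d a -> graded_quot_dim I d b -> a = b.
Proof.
by move=> Ha Hb; apply/eqP; rewrite eqn_leq !(@graded_quot_dim_le d).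
Qed.
End StandardMonomials.

(** * Power series modulo a power of the variable *)

Section TruncatedPowerSeries.
Variable R : comNzRingType.
Implicit Types (p q : {poly R}) (M : nat).

(** Congruence modulo ['X^M]; it replaces equality of formal power series, one truncation at a
    time. *)
Definition eq_modX M p q := forall i, (i < M)%N -> p`_i = q`_i.

Lemma eq_modX_mul M p q p' q' :
  eq_modX M p q -> eq_modX M p' q' -> eq_modX M (p * p') (q * q').
Proof.
move=> pq pq' i iM; rewrite !coefM; apply: eq_bigr => j _.
by rewrite pq ?pq' // (leq_ltn_trans _ iM) ?leq_subr // -ltnS.
Qed.

Lemma eq_modX_prod M (J : finType) (p q : J -> {poly R}) :
  (forall j, eq_modX M (p j) (q j)) -> eq_modX M (\prod_j p j) (\prod_j q j).
Proof.
move=> pq; apply: (big_ind2 (fun a b => eq_modX M a b)) => //.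
by move=> *; apply: eq_modX_mul.
Qed.

Lemma geometric_sum M : (1 - 'X) * \sum_(a < M) 'X^a = 1 - 'X^M :> {poly R}.
Proof.
rewrite -[1 in RHS](expr1n _ M) subrXX.
by under [in RHS]eq_bigr do rewrite expr1n mul1r.
Qed.

(** [1 - 'X] is invertible modulo ['X^M], its inverse being the truncated geometric series [G]. *)
Lemma eq_modX_cancel M k p q :
  eq_modX M ((1 - 'X) ^+ k * p) ((1 - 'X) ^+ k * q) -> eq_modX M p q.
Proof.
pose G : {poly R} := \sum_(a < M) 'X^a.
have inv r : eq_modX M r (G ^+ k * ((1 - 'X) ^+ k * r)).
  rewrite mulrA -exprMn [G * _]mulrC geometric_sum -[r in X in eq_modX _ X]mul1r.
  apply: eq_modX_mul => //; elim: k => // k IH.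
  have one : eq_modX M 1 (1 - 'X^M : {poly R}).
    by move=> j jM; rewrite coefB coefXn ltn_eqF // subr0.
  by have := eq_modX_mul one IH; rewrite mulr1 -exprS.
move=> pq i iM; rewrite (inv p) // (inv q) //.
by apply: eq_modX_mul iM.
Qed.
End TruncatedPowerSeries.

(** * Hilbert series attached to a partition of the vertices *)

Section MultipartiteSeries.
Variables (n p : nat) (A : 'I_p -> {set 'I_n}).

(** For [a] the size of a part, this is the contribution of that part to [(1 - 'X) ^+ 2] times the
    claimed h-polynomial. *)
Lemma sum_1_subXn a :
  (a < n)%N ->
  (1 - 'X) * (\sum_(1 <= i < a.+1) (1 - 'X^(n - i)))
    = a%:R * (1 - 'X) - 'X^(n - a) + 'X^n :> {poly int}.
Proof.
elim: a => [|a IH] an.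
  by rewrite big_geq // mulr0 mul0r sub0r subn0 addNr.
rewrite big_nat_recr //= mulrDr IH; last exact: ltnW.
have -> : (n - a = (n - a.+1).+1)%N by lia.
by rewrite exprS -natr1; ring.
Qed.

(** The claimed h-polynomial with the order of summation exchanged, so that a factor [1 - 'X]
    collapses each inner sum to [1 - 'X^(n - i)]. *)
Definition multipartite_h_poly : {poly int} :=
  \sum_(1 <= i < n) (part_count A i)%:P * \sum_(k < n - i) 'X^k.

Lemma coef_multipartite_h_poly k :
  multipartite_h_poly`_k = \sum_(1 <= i < n - k) part_count A i.
Proof.
rewrite coef_sum [RHS](big_nat_widen _ _ n) ?leq_subr // [RHS]big_mkcond /=.
apply: eq_big_nat => i /andP[i1 ni]; rewrite coefCM coef_sum.
have -> : (i < n - k)%N = (k < n - i)%N by lia.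
case: ltnP => kn.
  rewrite (bigD1 (Ordinal kn)) //= coefXn eqxx big1 ?addr0 ?mulr1 // => j jk.
  by rewrite coefXn; case: eqP => // kj; case/eqP: jk; apply/val_inj.
rewrite big1 ?mulr0 // => j _; rewrite coefXn; case: eqP => // kj.
by move: (ltn_ord j); rewrite -kj ltnNge kn.
Qed.

Hypothesis p_ge2 : (2 <= p)%N.
Hypothesis A_neq0 : forall j, A j != set0.
Hypothesis A_disj : forall i j, i != j -> [disjoint A i & A j].
Hypothesis A_cover : \bigcup_(i < p) A i = [set: 'I_n].
Implicit Types (m : 'X_{1..n}) (Z F : {set 'I_n}).

Definition zeros m : {set 'I_n} := [set i | m i == 0%N].

(** For the zero set of a monomial this says that the absent variables include both ends of some
    edge, that is, the monomial lies outside the cover ideal. *)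
Definition spread Z := [forall j, ~~ (Z \subset A j)].

Lemma part_exists v : exists j, v \in A j.
Proof.
by have : v \in [set: 'I_n] by []; rewrite -A_cover => /bigcupP[j _]; exists j.
Qed.

Lemma part_uniq v i j : v \in A i -> v \in A j -> i = j.
Proof.
move=> vi vj; apply/eqP; apply/negPn/negP => /A_disj/disjointFr/(_ vi).
by rewrite vj.
Qed.

Lemma spreadP Z :
  reflect (exists v w i j, [/\ v \in Z, w \in Z, i != j, v \in A i & w \in A j])
          (spread Z).
Proof.
apply: (iffP forallP) => [sZ|[v [w [i [j [vZ wZ ij vi wj]]]]] k]; last first.
  apply/negP => /subsetP sub; move: ij; rewrite (part_uniq vi (sub _ vZ)).
  by rewrite (part_uniq wj (sub _ wZ)) eqxx.
have j0 : 'I_p by exact: (Ordinal (ltnW p_ge2)).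
have /subsetPn[v vZ _] := sZ j0; have [i vi] := part_exists v.
have /subsetPn[w wZ wi] := sZ i; have [j wj] := part_exists w.
exists v, w, i, j; split=> //; apply: contraNneq wi => ->; exact: wj.
Qed.

(** The parts are disjoint, so a nonempty [Z] lies in at most one of them; the empty set lies in all
    [p], and the last term corrects the overcount. *)
Lemma spread_indicator (R : comNzRingType) Z :
  (spread Z)%:R = 1 - \sum_j (Z \subset A j)%:R + (Z == set0)%:R * (p%:R - 1) :> R.
Proof.
have [->|/set0Pn[v vZ]] := eqVneq Z set0.
  have -> : spread set0 = false.
    by apply/negbTE/forallPn; exists (Ordinal (ltnW p_ge2)); rewrite negbK sub0set.
  under eq_bigr do rewrite sub0set.
  by rewrite sumr_const card_ord /= mul1r addrC addrA subrK subrr.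
rewrite mul0r addr0; have [i vi] := part_exists v.
rewrite (bigD1 i) //= big1 ?addr0 => [|j ji]; last first.
  case: (boolP (Z \subset A j)) => //= /subsetP/(_ v vZ) vj.
  by rewrite (part_uniq vj vi) eqxx in ji.
suff -> : spread Z = ~~ (Z \subset A i) by case: (Z \subset A i); rewrite ?subrr ?subr0.
apply/forallP/idP => [//|nZi j]; apply: contra nZi => Zj.
by rewrite (part_uniq vi (subsetP Zj _ vZ)).
Qed.

Definition zeros_series M F : {poly int} :=
  \sum_(u : {ffun 'I_n -> 'I_M})
    (zeros (exps_mnm u) \subset F)%:R * 'X^(mdeg (exps_mnm u)).

(** The series factors over the variables: one in [F] contributes [1 / (1 - t)], one outside must
    occur and contributes [t / (1 - t)]. *)
Lemma zeros_seriesE M F :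
  eq_modX M ((1 - 'X) ^+ n * zeros_series M F) 'X^(n - #|F|).
Proof.
case: M => // M.
have -> : zeros_series M.+1 F =
    \prod_(i < n) \sum_(a < M.+1) ((a == 0 :> nat) ==> (i \in F))%:R * 'X^a.
  rewrite bigA_distr_bigA; apply: eq_bigr => u _; rewrite big_split /=.
  congr (_ * _).
    rewrite -natr_prod; congr (_%:R); apply/esym.
    case: subsetP => [sub|nsub].
      by apply: big1 => i _; case: eqP => //= ui; rewrite sub // inE mnmE ui.
    have /subsetPn[i] : ~~ (zeros (exps_mnm u) \subset F) by apply/subsetP.
    by rewrite inE mnmE => ui iF; rewrite (bigD1 i) //= ui (negbTE iF).
  by rewrite mdegE prodrXr; congr ('X^_); apply: eq_bigr => i _; rewrite mnmE.
rewrite -[n in _ ^+ n]card_ord -prodr_const -big_split /=.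
have -> : 'X^(n - #|F|) = \prod_(i < n) (if i \notin F then 'X else 1) :> {poly int}.
  rewrite -big_mkcond /= prodr_const; congr ('X^_).
  by apply: (canLR (addKn _)); rewrite -[LHS]card_ord -(cardC F).
apply: eq_modX_prod => i; rewrite big_ord_recl /= expr0 mulr1.
have := geometric_sum int M.+1; rewrite big_ord_recl expr0.
under eq_bigr do rewrite mul1r.
(* The truncation error ['X^(M.+1)] vanishes at the current precision. *)
move=> geo; suff -> : (1 - 'X) * ((i \in F)%:R + \sum_(a < M) 'X^(lift ord0 a))
    = (if i \notin F then 'X else 1) - 'X^(M.+1) :> {poly int}.
  by move=> k kM; rewrite coefB coefXn ltn_eqF // subr0.
case: (i \in F); first by rewrite geo.
by move: geo; rewrite mulrDr mulr1 mulr0n add0r => /(canRL (addKr _)) -> /=; ring.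
Qed.

Lemma std_series (std : pred 'X_{1..n}) M :
  (forall m, std m = spread (zeros m)) ->
  eq_modX M ((1 - 'X) ^+ n * \poly_(d < M) (#|std_exps std M d|)%:R)
    (1 - \sum_j 'X^(n - #|A j|) + (p%:R - 1) * 'X^n : {poly int}).
Proof.
move=> stdE; pose G : {poly int} := \sum_(u : {ffun 'I_n -> 'I_M})
  (spread (zeros (exps_mnm u)))%:R * 'X^(mdeg (exps_mnm u)).
have GE : eq_modX M (\poly_(d < M) (#|std_exps std M d|)%:R) G.
  move=> d dM; rewrite coef_poly dM coef_sum -sum1_card natr_sum big_mkcond /=.
  apply: eq_bigr => u _; rewrite inE stdE -mulr_natl mulr1.
  rewrite -[_%:R in RHS]/(_%:R) -polyC_natr coefCM coefXn eq_sym.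
  by case: (_ == _); case: (spread _).
(* Sum [spread_indicator] over all monomials; inclusion in [setT] and in [set0] encodes its constant
   term and its empty-set term. *)
have GS : G = zeros_series M setT - \sum_j zeros_series M (A j)
    + (p%:R - 1) * zeros_series M set0.
  rewrite /zeros_series exchange_big mulr_sumr -sumrB -big_split /=.
  apply: eq_bigr => u _; rewrite spread_indicator subsetT subset0 -mulr_suml.
  by rewrite (_ : true%:R = 1) //; ring.
have Es F i (iM : (i < M)%N) := @zeros_seriesE M F i iM.
move=> i iM; rewrite (eq_modX_mul (fun _ _ => erefl) GE iM) GS.
rewrite mulrDr mulrBr [_ * \sum_j zeros_series _ _]mulr_sumr.
rewrite [_ * (_ * zeros_series _ _)]mulrCA.
rewrite !coefD !coefN !coef_sum.
rewrite Es // cardsT card_ord subnn expr0; congr (_ - _ + _).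
  by apply: eq_bigr => j _; rewrite Es.
by apply: eq_modX_mul iM => // k kM; rewrite Es // cards0 subn0.
Qed.

Lemma sum_card_parts : (\sum_j #|A j| = n)%N.
Proof.
transitivity (\sum_j \sum_v (v \in A j : nat))%N.
  by apply: eq_bigr => j _; rewrite -sum1_card big_mkcond.
rewrite exchange_big /= -[RHS]card_ord -sum1_card; apply: eq_bigr => v _.
have [j vj] := part_exists v; rewrite (bigD1 j) //= vj big1 // => i ij.
by case: (boolP (v \in A i)) => // vi; rewrite (part_uniq vi vj) eqxx in ij.
Qed.

Lemma card_part_lt j : (#|A j| < n)%N.
Proof.
(* As [p >= 2], there is a part other than [A j], and it is nonempty. *)
pose i : 'I_p :=
  if j == Ordinal (ltnW p_ge2) then Ordinal p_ge2 else Ordinal (ltnW p_ge2).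
have ij : i != j.
  by rewrite /i; case: (eqVneq j) => [->|]; rewrite // eq_sym.
rewrite -[leqRHS]sum_card_parts (bigD1 j) //= -addn1 leq_add2l (bigD1 i) //=.
by rewrite addn_gt0 card_gt0 A_neq0.
Qed.

(** The left side splits over the parts by [sum_1_subXn]; the multiples of [1 - 'X] combine to a
    single one because the part sizes add up to [n]. *)
Lemma multipartite_h_polyE :
  (1 - 'X) ^+ 2 * multipartite_h_poly
    = 1 - \sum_j 'X^(n - #|A j|) + (p%:R - 1) * 'X^n.
Proof.
have n_gt0 : (0 < n)%N := leq_ltn_trans (leq0n _) (card_part_lt (Ordinal p_ge2)).
(* Padding the range to one common to all parts allows the sums over [i] and [j] to be exchanged. *)
have trunc a : (a < n)%N ->
    (1 - 'X) * (\sum_(1 <= i < n) (i <= a)%:R * (1 - 'X^(n - i)))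
    = a%:R * (1 - 'X) - 'X^(n - a) + 'X^n :> {poly int}.
  move=> an; rewrite -sum_1_subXn // (big_nat_widen _ a.+1 n) //.
  rewrite [in RHS]big_mkcond /=; congr (_ * _); apply: eq_bigr => i _.
  by rewrite ltnS; case: (i <= a)%N; rewrite ?mul1r ?mul0r.
have pc i : (part_count A i)%:P = \sum_j (i <= #|A j|)%:R - 1 :> {poly int}.
  rewrite /part_count polyCB polyC1; congr (_ - _).
  rewrite -natz polyC_natr -sum1_card natr_sum big_mkcond /=.
  by apply: eq_bigr => j _; rewrite inE; case: (_ <= _)%N.
rewrite expr2 -mulrA /multipartite_h_poly [X in _ * X]mulr_sumr.
under eq_bigr => i _ do rewrite mulrCA geometric_sum pc mulrBl mul1r mulr_suml.
rewrite sumrB exchange_big mulrBr mulr_sumr /=.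
under eq_bigr => j _ do rewrite trunc ?card_part_lt //.
(* The [-1] in [part_count] contributes the same sum with [a = n.-1]. *)
have := @sum_1_subXn n.-1; rewrite !prednK // => -> //.
rewrite !big_split /= -mulr_suml -natr_sum sum_card_parts sumrN sumr_const card_ord.
rewrite (_ : n - n.-1 = 1)%N; last by lia.
rewrite -[in n%:R](prednK n_gt0) -natr1 expr1 -[_ *+ p]mulr_natl; ring.
Qed.
End MultipartiteSeries.

(** Hilbert function and Krull dimension are both determined by [I], and they determine [h]; this
    pins down the value chosen by [epsilon]. *)
Lemma h_polynomial_spec_uniq (K : fieldType) (n : nat) (std : pred 'X_{1..n})
    (I : {mpoly K[n]} -> Prop) (h h' : {poly int}) :
  (forall f, I f <-> forall m, std m -> f@_m = 0) ->
  h_polynomial_spec I h -> h_polynomial_spec I h' -> h = h'.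
Proof.
move=> memI [H [D [dimH [chD maxD] hE]]] [H' [D' [dimH' [chD' maxD'] hE']]].
have HH' d : H d = H' d := graded_quot_dim_uniq memI (dimH d) (dimH' d).
have DD' : D = D' by apply/eqP; rewrite eqn_leq maxD ?maxD'.
apply/polyP => m; rewrite -hE -hE' DD'; apply: eq_bigr => j _.
by rewrite HH'.
Qed.

(** * The cover ideal of a one-dimensional matroid *)

Section RankTwoMatroid.
Variables (n : nat) (Delta : {set {set 'I_n}}).
Hypothesis matroidDelta : matroid_complex Delta.
Hypothesis dimDelta : complex_dim Delta = 1.

Lemma max_face_card : (\max_(F in Delta) #|F| = 2)%N.
Proof. by move: dimDelta; rewrite /complex_dim; lia. Qed.

Lemma face_card_le2 F : F \in Delta -> (#|F| <= 2)%N.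
Proof.
rewrite -max_face_card => FD.
exact: (leq_bigmax_cond (F := fun F : {set _} => #|F|)).
Qed.

(** Some face has two elements, and the exchange property enlarges any smaller face from it, so all
    maximal faces are edges. *)
Lemma facet_edgeP F :
  reflect (exists v w, edge Delta v w /\ F = [set v; w]) (facet Delta F).
Proof.
have [[D0 _] _ exch] := matroidDelta.
apply: (iffP maxsetP) => [[FD maxF]|[v [w [/andP[vw vwD] ->]]]]; last first.
  split=> // G GD vwG; apply/esym/eqP.
  by rewrite eqEcard vwG cards2 vw face_card_le2.
have [G GD G2] : exists2 G, G \in Delta & #|G| = 2%N.
  have [|G GD maxG] := @eq_bigmax_cond _ (mem Delta) (fun F : {set _} => #|F|).
    by apply/card_gt0P; exists set0.
  by exists G => //; rewrite -max_face_card.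
have : #|F| == 2%N.
  rewrite eqn_leq face_card_le2 //= leqNgt; apply/negP => F2.
  have [|i] := exch F G FD GD; first by rewrite G2.
  rewrite inE => /andP[iF _] /maxF/(_ (subsetUr _ _)) FE.
  by move: iF; rewrite -FE !inE eqxx.
move/cards2P => [v [w [vw FE]]]; exists v, w; split=> //.
by rewrite /edge vw -FE.
Qed.

Variables (K : fieldType) (p : nat) (A : 'I_p -> {set 'I_n}).
Hypothesis multiA : complete_multipartite (edge Delta) A.

Local Notation std := (fun m : 'X_{1..n} => spread A (zeros m)).

Lemma spread_facetP (Z : {set 'I_n}) :
  reflect (exists2 F, facet Delta F & F \subset Z) (spread A Z).
Proof.
have [p2 A0 disj cov edgeE] := multiA.
apply: (iffP (spreadP p2 disj cov _)).
  move=> [v [w [i [j [vZ wZ ij vi wj]]]]]; exists [set v; w].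
    by apply/facet_edgeP; exists v, w; split=> //; apply/edgeE; exists i, j.
  by rewrite subUset !sub1set vZ wZ.
move=> [F /facet_edgeP[v [w [/edgeE[i [j [ij vi wj]]] ->]]]].
rewrite subUset !sub1set => /andP[vZ wZ].
by exists v, w, i, j.
Qed.

(** A monomial is outside the ideal of [F] exactly when its absent variables contain [F], hence
    outside the intersection when they contain some facet. *)
Lemma cover_idealP (f : {mpoly K[n]}) :
  cover_ideal Delta f <-> forall m, std m -> f@_m = 0.
Proof.
have vanE F m : vanishes_on F m = (F \subset zeros m).
  apply/forallP/subsetP => [Fm i iF|sub i].
    by have := Fm i; rewrite iF inE.
  by apply/implyP => /sub; rewrite inE.
split=> [Jf m /spread_facetP[F facF Fm]|f0 F facF].
  by have /var_idealP/killed_idealP := Jf F facF; apply; rewrite vanE.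
apply/var_idealP/killed_idealP => m; rewrite vanE => Fm.
by apply: f0; apply/spread_facetP; exists F.
Qed.

Lemma facet_card F : facet Delta F -> #|F| = 2%N.
Proof. by move=> /facet_edgeP[v [w [/andP[vw _] ->]]]; rewrite cards2 vw. Qed.

Lemma facet_exists : exists F, facet Delta F.
Proof.
have [[D0 _] _ _] := matroidDelta.
by have [F] := maxset_exists (P := mem Delta) D0; exists F.
Qed.

(* If [P] contained the variables of no facet, the product of the variables
   outside [P] would be in the cover ideal but not in [P]. *)
Lemma prime_cover_ideal (P : {pred {mpoly K[n]}}) :
  idealr_closed P -> prime_idealr_closed P ->
  (forall f, cover_ideal Delta f -> f \in P) ->
  exists2 F, facet Delta F & forall i, i \in F -> 'X_i \in P.
Proof.
move=> idP prP JP; pose Z := [set i | ('X_i : {mpoly K[n]}) \in P].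
have [/existsP[F /andP[facF FZ]]|/existsPn noF] :=
  boolP [exists F, facet Delta F && (F \subset Z)].
  by exists F => // i iF; have := subsetP FZ i iF; rewrite inE.
have /negP[] : \prod_(i | i \notin Z) ('X_i : {mpoly K[n]}) \notin P.
  by apply: prime_prod_notin => // i; rewrite inE.
apply: JP => F facF; have := noF F; rewrite facF /= => /subsetPn[i iF iZ].
have [idF _] := killed_ideal_prime K F.
apply/var_idealP; rewrite (bigD1 i) //= mulrC.
by apply: (idealMl idF); rewrite killed_idealX.
Qed.

(** Any facet gives a chain of length [n - 2], and every prime over the cover ideal contains the two
    variables of some facet. *)
Lemma krull_dim_cover_ideal : krull_dim_quot (@cover_ideal K n Delta) (n - 2).
Proof.
have [F facF] := facet_exists; rewrite -(facet_card facF); split.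
  by apply: krull_chain => f; apply.
move=> e; apply: krull_bound => P idP prP JP.
have [G facG GP] := prime_cover_ideal idP prP JP.
by exists G; rewrite ?facet_card.
Qed.

Lemma h_polynomial_spec_cover_ideal :
  h_polynomial_spec (@cover_ideal K n Delta) (multipartite_h_poly A).
Proof.
have [p2 A0 disj cov _] := multiA.
have n2 : (2 <= n)%N.
  have [F facF] := facet_exists.
  by rewrite -(facet_card facF) -[leqRHS]card_ord max_card.
exists (fun d => #|std_exps std d.+1 d|), (n - 2)%N; split.
- by move=> d; apply: graded_quot_dim_std cover_idealP _ _ _.
- exact: krull_dim_cover_ideal.
(* Multiplying by [(1 - 'X) ^+ 2] brings both sides to the numerator over [(1 - 'X) ^+ n]; the
   factor is then cancelled. *)
move=> m; have key : eq_modX m.+1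
    ((1 - 'X) ^+ (n - 2) * \poly_(d < m.+1) (#|std_exps std m.+1 d|)%:R)
    (multipartite_h_poly A).
  apply: (eq_modX_cancel (k := 2)); rewrite mulrA -exprD subnKC //.
  by rewrite multipartite_h_polyE //; apply: std_series.
rewrite -key // coefM; apply: eq_bigr => j _; congr (_ * _).
have jm : (m - j < m.+1)%N by rewrite ltnS leq_subr.
rewrite coef_poly jm natz; congr Posz.
(* The exponent caps [(m - j).+1] and [m.+1] differ, but both counts are the dimension of the same
   graded piece. *)
by apply: (graded_quot_dim_uniq cover_idealP);
  apply: graded_quot_dim_std cover_idealP _ _ _.
Qed.
End RankTwoMatroid.

Theorem proposition2p10 (K : fieldType) (n : nat) (Delta : {set {set 'I_n}})
    (p : nat) (A : 'I_p -> {set 'I_n})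
    (HDelta : matroid_complex Delta)
    (Hdim : complex_dim Delta = 1)
    (HA : complete_multipartite (edge Delta) A)
    (k : nat) (Hk : (k <= n - 2)%N) :
  h_matroid K Delta k = \sum_(1 <= i < n - k) part_count A i.
Proof.
have specA := h_polynomial_spec_cover_ideal HDelta Hdim K HA.
rewrite -coef_multipartite_h_poly /h_matroid /h_vector.
(* [epsilon] returns a solution of the spec because [multipartite_h_poly A] is one; uniqueness
   identifies the two. *)
have specH : h_polynomial_spec (@cover_ideal K n Delta)
    (h_polynomial (@cover_ideal K n Delta)).
  by apply: epsilon_spec; exists (multipartite_h_poly A).
by rewrite (h_polynomial_spec_uniq (cover_idealP HDelta Hdim HA) specH specA).
Qed.
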